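(* Let $\Bbbk$ be an algebraically closed field and $A$ a finite dimensional selfinjective $\Bbbk$-algebra. Then $\operatorname{HHdim} T(A)=\infty$.
   Context: $T(A)=A\ltimes DA$ is the trivial extension: the vector space $A\oplus DA$, where $DA=\operatorname{Hom}_\Bbbk(A,\Bbbk)$ with its natural bimodule structure, with multiplication $(a,f)(b,g)=(ab,ag+fb)$. For a finite dimensional algebra $B$, $\operatorname{HH}_n(B)=\operatorname{Tor}^{B\otimes_\Bbbk B^{\mathrm{op}}}_n(B,B)$ is the $n$-th Hochschild homology group, and $\operatorname{HHdim}B=\sup\{n\mid \operatorname{HH}_n(B)\neq 0\}$. *)

(* Defs.v *)
(* Finite-dimensional algebras are given by structure
   constants with respect to a basis e_0, ..., e_(d-1). *)
From HB Require Import structures.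
From mathcomp Require Import all_boot all_order all_algebra.
Set Implicit Arguments. Unset Strict Implicit. Unset Printing Implicit Defensive.
Import Order.TTheory GRing.Theory.
Local Open Scope ring_scope.

(* A finite dimensional K-algebra presented by structure constants:
   fd_mul i j = e_i * e_j (coordinates), fd_one = coordinates of 1. *)
Record fdalg (K : fieldType) := FDAlg {
  fd_dim : nat;
  fd_mul : 'I_fd_dim -> 'I_fd_dim -> 'rV[K]_fd_dim;
  fd_one : 'rV[K]_fd_dim }.
Arguments fd_dim {K} _.
Arguments fd_mul {K} _ _ _.
Arguments fd_one {K} _.

Section FD.
Variable K : fieldType.

Definition fdmul (A : fdalg K) (x y : 'rV[K]_(fd_dim A)) : 'rV[K]_(fd_dim A) :=
  \sum_(i < fd_dim A) \sum_(j < fd_dim A) (x 0 i * y 0 j) *: fd_mul A i j.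
Arguments fdmul : clear implicits.

Definition is_fdalg (A : fdalg K) : Prop :=
  [/\ (0 < fd_dim A)%N,
      (forall x y z, fdmul A (fdmul A x y) z = fdmul A x (fdmul A y z)),
      (forall x, fdmul A (fd_one A) x = x) &
      (forall x, fdmul A x (fd_one A) = x)].

(* A right A-module of dimension m: rho i is the matrix of v |-> v . e_i
   acting on row vectors. *)
Definition act (A : fdalg K) m (rho : 'I_(fd_dim A) -> 'M[K]_m)
  (x : 'rV[K]_(fd_dim A)) : 'M[K]_m := \sum_(i < fd_dim A) x 0 i *: rho i.

Definition is_rmod (A : fdalg K) m (rho : 'I_(fd_dim A) -> 'M[K]_m) : Prop :=
  act rho (fd_one A) = 1%:M /\
  forall x y, act rho x *m act rho y = act rho (fdmul A x y).

Definition is_hom (A : fdalg K) m n (rho : 'I_(fd_dim A) -> 'M[K]_m)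
  (sigma : 'I_(fd_dim A) -> 'M[K]_n) (f : 'M[K]_(m, n)) : Prop :=
  forall i, rho i *m f = f *m sigma i.

Definition reg_rmod (A : fdalg K) (i : 'I_(fd_dim A)) : 'M[K]_(fd_dim A) :=
  \matrix_(j, k) fd_mul A j i 0 k.

(* A is selfinjective: A_A is an injective right A-module (tested against
   finite dimensional modules, which suffices by Baer's criterion). *)
Definition selfinjective (A : fdalg K) : Prop :=
  forall m n (rho : 'I_(fd_dim A) -> 'M[K]_m) (sigma : 'I_(fd_dim A) -> 'M[K]_n)
    (i : 'M[K]_(m, n)) (f : 'M[K]_(m, fd_dim A)),
    is_rmod rho -> is_rmod sigma ->
    row_free i -> is_hom rho sigma i -> is_hom rho (@reg_rmod A) f ->
    exists g : 'M[K]_(n, fd_dim A),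
      is_hom sigma (@reg_rmod A) g /\ i *m g = f.

(* basis: e_0..e_(d-1) of A followed by the dual basis e_0^*..e_(d-1)^* of DA;
   (a,f)(b,g) = (ab, ag + fb) with (a g)(x) = g(x a), (f b)(x) = f(b x). *)
Definition triv_mul (A : fdalg K) (i j : 'I_(fd_dim A + fd_dim A))
  : 'rV[K]_(fd_dim A + fd_dim A) :=
  match split i, split j with
  | inl a, inl b => row_mx (fd_mul A a b) 0
  | inl a, inr b => row_mx 0 (\row_k fd_mul A k a 0 b)
  | inr a, inl b => row_mx 0 (\row_k fd_mul A b k 0 a)
  | inr _, inr _ => 0
  end.

Definition triv_ext (A : fdalg K) : fdalg K :=
  @FDAlg K (fd_dim A + fd_dim A) (@triv_mul A) (row_mx (fd_one A) 0).

(* C_n(B) = B^{⊗(n+1)}, with basis indexed by functions 'I_(n+1) -> 'I_d *)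
Definition hchain (B : fdalg K) (n : nat) : finType := {ffun 'I_n.+1 -> 'I_(fd_dim B)}.

(* coefficient of the basis tensor t in d_i(e_s) for i <= n (multiply
   factors i and i+1) *)
Definition face_coef (B : fdalg K) n (i : nat) (s : hchain B n.+1) (t : hchain B n) : K :=
  (([forall j : 'I_n.+1, (j < i)%N ==> (t j == s (inord j))] &&
    [forall j : 'I_n.+1, (i < j)%N ==> (t j == s (inord j.+1))])%:R)
  * fd_mul B (s (inord i)) (s (inord i.+1)) 0 (t (inord i)).

(* coefficient of t in d_{n+1}(e_s) = e_{s(n+1)} e_{s 0} ⊗ e_{s 1} ⊗ ... ⊗ e_{s n} *)
Definition last_coef (B : fdalg K) n (s : hchain B n.+1) (t : hchain B n) : K :=
  ([forall j : 'I_n.+1, (0 < j)%N ==> (t j == s (inord j))]%:R)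
  * fd_mul B (s (inord n.+1)) (s (inord 0)) 0 (t (inord 0)).

(* matrix of the Hochschild boundary b : C_{n+1} -> C_n (row-vector convention) *)
Definition hboundary (B : fdalg K) n : 'M[K]_(#|hchain B n.+1|, #|hchain B n|) :=
  \matrix_(r, c)
    (\sum_(i < n.+1) (-1) ^+ i * face_coef i (enum_val r) (enum_val c)
     + (-1) ^+ n.+1 * last_coef (enum_val r) (enum_val c)).

(* row space of the cycles Z_n = ker (b : C_n -> C_{n-1}), with b_0 = 0 *)
Definition hcycles (B : fdalg K) (n : nat) : 'M[K]_(#|hchain B n|) :=
  match n return 'M[K]_(#|hchain B n|) with
  | 0 => 1%:M
  | n'.+1 => kermx (hboundary B n')
  end.

Definition HH_nonzero (B : fdalg K) (n : nat) : bool :=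
  ~~ (hcycles B n <= hboundary B n)%MS.

Definition HHdim_infinite (B : fdalg K) : Prop :=
  forall N : nat, exists n : nat, (N <= n)%N /\ HH_nonzero B n.

End FD.

(* Main.v *)
(* Every tensor of elements of DA is a Hochschild cycle of T(A), because
   DA * DA = 0, so it suffices to find functionals on DA^{⊗m} that kill the
   boundaries of tensors with one factor in A.  If [θ : DA -> End V] is linear
   with [θ(f a) θ(g) = θ(f) θ(a g)] and [θ u = (-1)^(m-1) u θ], then
   [f_1 ⊗ ... ⊗ f_m |-> tr (u θ(f_1) ... θ(f_m))] is such a functional.
   Selfinjectivity splits A -> DA^d, giving right A-linear maps g_j : DA -> A and
   f_j in DA with Σ g_j(f_j) = 1; the operators [x |-> g_j(x f)] on A satisfy the
   relation and are not nilpotent.  Passing to an irreducible subquotient gives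
   words of nonzero trace (K is algebraically closed), with [u = 1] for odd m or,
   if V is Z/2-graded with θ odd, with [u] the grading operator for even m. *)
Require Import Defs.
From mathcomp Require Import all_boot all_order all_algebra.
From mathcomp Require Import zify ring mxtens.
From Stdlib Require Import Classical.
Set Implicit Arguments. Unset Strict Implicit. Unset Printing Implicit Defensive.
Import GRing.Theory.
Local Open Scope ring_scope.

(** * Families of matrices and traces of words *)

Definition subspace (K : fieldType) n (S : 'rV[K]_n -> Prop) : Prop :=
  S 0 /\ forall c u v, S u -> S v -> S (c *: u + v).

(** Adjoining to [U] a vector of [S] outside its row space raises the rank, so at most [n] such
    steps are possible. *)
Lemma subspace_mx (K : fieldType) n (S : 'rV[K]_n -> Prop) :
  subspace S -> exists U : 'M[K]_n, forall v, S v <-> (v <= U)%MS.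
Proof.
move=> Ssub; have [S0 Slin] := Ssub.
suff grow k (U : 'M[K]_n) : (n - \rank U <= k)%N ->
    (forall v, (v <= U)%MS -> S v) ->
    exists U : 'M[K]_n, forall v, S v <-> (v <= U)%MS.
  apply: (grow n 0); first exact: leq_subr.
  by move=> v; rewrite submx0 => /eqP ->.
elim: k U => [|k IHk] U rkU SU.
  exists U => v; split; last exact: SU.
  move=> _; apply: submx_full; rewrite -col_leq_rank -subn_eq0 -leqn0 //.
have [US|] := classic (forall v, S v -> (v <= U)%MS).
  by exists U => v; split; [apply: US | apply: SU].
move=> /not_all_ex_not [v nSU]; have [Sv nvU] := imply_to_and _ _ nSU.
apply: (IHk (U + v)%MS); last first.
  move=> w /sub_addsmxP [[a b] /= ->].
  rewrite addrC [b]mx11_scalar mul_scalar_mx; apply: Slin => //.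
  exact/SU/submxMl.
have ltU : (\rank U < \rank (U + v)%MS)%N.
  apply: rank_ltmx; rewrite ltmxE addsmxSl /=; apply/negP => sub; apply: nvU.
  exact: submx_trans (addsmxSr _ _) sub.
have := rank_leq_col (U + v)%MS; lia.
Qed.

(* The extremal element of least rank has rank one: every compression of the
   set to the row space of such an element is scalar. *)
Lemma exists_mxtrace_neq0 (K : closedFieldType) n (S : 'M[K]_n -> Prop)
    (u : 'M[K]_n) :
  (forall c x y, S x -> S y -> S (c *: x + y)) ->
  (forall x y z, S x -> S y -> S z -> S (x *m y *m z)) ->
  (forall v w : 'rV_n, v != 0 -> exists2 a, S a & v *m a = w) ->
  u != 0 -> exists2 x, S x & \tr (u *m x) != 0.
Proof.
move=> Slin Strip Strans u0.
have [v v0 vu0] : exists2 v : 'rV_n, v != 0 & v *m u != 0.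
  have [i ui0] : exists i, row i u != 0.
    apply/existsP; apply: contraR u0; rewrite negb_exists => /forallP rowu0.
    by apply/eqP/row_matrixP => i; rewrite row0; apply/eqP/negPn/rowu0.
  exists (delta_mx 0 i); last by rewrite -rowE.
  by apply: contraNneq ui0 => dl0; rewrite rowE dl0 mul0mx.
have dual m (C : 'M[K]_(n, m)) (w : 'rV_m) : row_full C ->
    exists a : 'rV_n, a *m C = w.
  by move=> fullC; have /submxP [a ->] := submx_full w fullC; exists a.
have key k (T : 'M[K]_n) : (\rank T <= k)%N -> T != 0 -> S T ->
    exists2 T : 'M[K]_n, \rank T = 1%N & S T.
  elim: k T => [|k IHk] T rkT T0 ST.
    by move: T0; rewrite -mxrank_eq0 -leqn0 rkT.
  case rkT1: (\rank T) => [|[|r]].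
  - by move: T0; rewrite -mxrank_eq0 rkT1.
  - by exists T.
  (* In a rank factorization [T = C *m R], subtracting an eigenvalue from [R *m a *m C] gives a
     singular [N], so [C *m N *m R] has smaller rank. It is nonzero because row [R0] of
     [R *m a *m C] is the unit vector at [R1], with [R1] different from [R0]. *)
  have [C [R [TE fullC freeR]]] :
      exists C : 'M_(n, \rank T), exists R : 'M_(\rank T, n),
        [/\ T = C *m R, row_full C & row_free R].
    by exists (col_base T), (row_base T);
      rewrite mulmx_base col_base_full row_base_free.
  have [R0 [R1 ne01]] : exists i j : 'I_(\rank T), i != j.
    by rewrite rkT1; exists (@Ordinal r.+2 0 isT), (@Ordinal r.+2 1 isT).
  have rowR0 : row R0 R != 0.
    apply: contraTneq freeR => rR0.
    apply/negP => /row_freeP [B RB].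
    have := congr1 (row R0) RB; rewrite row_mul rR0 mul0mx row1.
    move=> /rowP /(_ R0); rewrite !mxE !eqxx => /eqP.
    by rewrite eq_sym oner_eq0.
  have [w wC] := dual _ C (delta_mx 0 R1) fullC.
  have [a Sa aw] := Strans _ w rowR0.
  have szp : size (char_poly (R *m a *m C)) != 1%N.
    by rewrite size_char_poly rkT1.
  have [lam] := closed_rootP _ szp.
  rewrite -eigenvalue_root_char => /eigenvalueP [x xlam x0].
  pose N := R *m a *m C - lam%:M.
  have ST' : S (C *m N *m R).
    have -> : C *m N *m R = - lam *: T + T *m a *m T.
      rewrite /N mulmxBr mulmxBl mul_mx_scalar -scalemxAl -TE scaleNr addrC.
      congr (_ + _).
      by rewrite [RHS](congr2 (fun x y => x *m a *m y) TE TE) !mulmxA.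
    exact/Slin/Strip.
  apply: (IHk _ _ _ ST').
    have rkN : (\rank N < \rank T)%N.
      rewrite ltn_neqAle rank_leq_row andbT; apply/negP => /row_freeP [B NB].
      move: x0; rewrite -[x]mulmx1 -NB mulmxA mulmxBr xlam mul_mx_scalar.
      by rewrite subrr mul0mx eqxx.
    rewrite -ltnS; apply: leq_trans rkT; apply: leq_ltn_trans rkN.
    exact: leq_trans (mxrankM_maxl (C *m N) R) (mxrankM_maxr C N).
  apply/eqP => CNR0.
  have : N = 0.
    have /row_fullP [B BC] := fullC.
    have /row_freeP [D RD] := freeR.
    have -> : N = B *m (C *m N *m R) *m D.
      by rewrite !mulmxA BC mul1mx -mulmxA RD mulmx1.
    by rewrite CNR0 mulmx0 mul0mx.
  move=> /subr0_eq /(congr1 (row R0)) /rowP /(_ R1).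
  rewrite !row_mul aw wC !mxE !eqxx (negPf ne01) => /eqP.
  by rewrite oner_eq0.
have [T ST T0] : exists2 T, S T & T != 0.
  have [a Sa va] := Strans v v v0; exists a => //.
  by apply: contraNneq v0 => a0; rewrite -va a0 mulmx0.
have [{ST T0}T rkT ST] := key _ T (leqnn _) T0 ST.
pose C := col_base T; pose R := row_base T.
have TE : T = C *m R by rewrite mulmx_base.
have fullC : row_full C by exact: col_base_full.
move: C R TE fullC; rewrite rkT => C R TE fullC.
have R0 : R != 0.
  by apply: contra_eq_neq rkT => R0; rewrite TE R0 mulmx0 mxrank0.
have [w wC] := dual _ C 1%:M fullC.
have [b Sb Rb] := Strans R v R0.
have [a Sa vua] := Strans _ w vu0.
(* Here [C] is a column and [R] a row, so by cyclicity the trace is the scalar [v *m u *m a *m C],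
   which is 1. *)
exists (a *m T *m b); first exact: Strip.
have -> : u *m (a *m T *m b) = (u *m a *m C) *m (R *m b).
  by rewrite TE !mulmxA.
by rewrite mxtrace_mulC Rb !mulmxA vua wC mxtrace1 oner_eq0.
Qed.

Inductive mxspan (K : fieldType) n (P : 'M[K]_n -> Prop) : 'M[K]_n -> Prop :=
| mxspan0 : mxspan P 0
| mxspanD c x y of P x & mxspan P y : mxspan P (c *: x + y).

Lemma mxspan_lin (K : fieldType) n (P : 'M[K]_n -> Prop) c x y :
  mxspan P x -> mxspan P y -> mxspan P (c *: x + y).
Proof.
move=> Px Py; elim: Px => [|a z t Pz _ IH]; first by rewrite scaler0 add0r.
by rewrite scalerDr scalerA -addrA; apply: mxspanD.
Qed.

Lemma mem_mxspan (K : fieldType) n (P : 'M[K]_n -> Prop) x : P x -> mxspan P x.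
Proof.
by move=> Px; rewrite -[x]scale1r -[_ *: x]addr0; apply: mxspanD; last left.
Qed.

Lemma mxspan_mul (K : fieldType) n (P Q T : 'M[K]_n -> Prop) :
  (forall x y, P x -> Q y -> T (x *m y)) ->
  forall x y, mxspan P x -> mxspan Q y -> mxspan T (x *m y).
Proof.
move=> PQT x y Px Qy; elim: Px => [|a z t Pz _ IH].
  by rewrite mul0mx; left.
rewrite mulmxDl -scalemxAl; apply: mxspan_lin => //.
elim: Qy => [|b s r Qs _ IHs]; first by rewrite mulmx0; left.
by rewrite mulmxDr -scalemxAr; apply: mxspanD => //; apply: PQT.
Qed.

(** * Words in a family of matrices *)

Section Words.
Variables (K : fieldType) (I : Type).

Definition wprod n (X : I -> 'M[K]_n) (w : seq I) : 'M[K]_n :=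
  foldr (fun i M => X i *m M) 1%:M w.

Definition nonnilpotent n (X : I -> 'M[K]_n) : Prop :=
  forall m, exists2 w, size w = m & wprod X w != 0.

(** For [g = 1] this is ordinary irreducibility; [g = 2] expresses irreducibility under the words of
    even length. *)
Definition irreducible_words n (X : I -> 'M[K]_n) (g : nat) : Prop :=
  forall S, subspace S ->
    (forall w v, size w = g -> S v -> S (v *m wprod X w)) ->
    (exists2 v, S v & v != 0) -> forall v, S v.

Lemma wprod_cat n (X : I -> 'M[K]_n) w1 w2 :
  wprod X (w1 ++ w2) = wprod X w1 *m wprod X w2.
Proof. by elim: w1 => [|i w1 IH] /=; rewrite ?mul1mx // IH mulmxA. Qed.

Lemma wprod1 n (X : I -> 'M[K]_n) i : wprod X [:: i] = X i.
Proof. exact: mulmx1. Qed.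

Lemma nonnilpotentS n (X : I -> 'M[K]_n) :
  (forall m, exists2 w, (m <= size w)%N & wprod X w != 0) -> nonnilpotent X.
Proof.
move=> H m; have [w mw w0] := H m; exists (take m w); first exact: size_takel.
apply: contraNneq w0 => tw0.
by rewrite -(cat_take_drop m w) wprod_cat tw0 mul0mx.
Qed.

End Words.

(** [exists_mxtrace_neq0] applies to the span of the words with length in [L]. The images of a
    nonzero [v] form a subspace stable under words of length [g], hence everything unless they all
    vanish; in that case the vectors killed by these words are everything, against nonnilpotency.
    Asking for triple sums rather than double ones admits the odd lengths. *)
Lemma exists_wprod_mxtrace_neq0 (K : closedFieldType) (I : Type) n
    (X : I -> 'M[K]_n) (g : nat) (L : nat -> Prop) (u : 'M_n) :
  irreducible_words X g -> nonnilpotent X ->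
  (exists l, L l) -> (forall l, L l -> L (g + l)%N) ->
  (forall a b c, L a -> L b -> L c -> L (a + b + c)%N) -> u != 0 ->
  exists2 w, L (size w) & \tr (u *m wprod X w) != 0.
Proof.
move=> Xirr Xnil [l0 Ll0] Lg L3 u0.
pose W (M : nat -> Prop) (x : 'M_n) := exists2 w, M (size w) & x = wprod X w.
have WM (M1 M2 M3 : nat -> Prop) x y :
    (forall a b, M1 a -> M2 b -> M3 (a + b)%N) -> W M1 x -> W M2 y -> W M3 (x *m y).
  move=> M123 [w Mw ->] [t Mt ->]; exists (w ++ t); last by rewrite wprod_cat.
  by rewrite size_cat; apply: M123.
have [x Sx trx] : exists2 x, mxspan (W L) x & \tr (u *m x) != 0.
  apply: exists_mxtrace_neq0 => //.
  - by move=> c x y; apply: mxspan_lin.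
  - pose L2 m := exists a b, [/\ L a, L b & m = (a + b)%N].
    move=> x y z Sx Sy; apply: (@mxspan_mul _ _ (W L2)).
      move=> x' y'; apply: WM => ab c [a [b [La Lb ->]]] Lc; exact: L3.
    apply: mxspan_mul Sx Sy => x' y'; apply: WM => a b La Lb.
    by exists a, b.
  - move=> v w v0.
    pose S := fun w => exists2 a, mxspan (W L) a & v *m a = w.
    suff: S w by [].
    apply: (Xirr S).
    + split; first by exists 0; [left | rewrite mulmx0].
      move=> c x y [a Sa <-] [b Sb <-]; exists (c *: a + b).
        exact: mxspan_lin.
      by rewrite mulmxDr scalemxAr.
    + move=> t y tg [a Sa <-]; exists (a *m wprod X t); last by rewrite mulmxA.
      apply: (@mxspan_mul _ _ (W L) (W (fun k => k = g))) Sa _.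
        by move=> x z; apply: WM => k _ Lk ->; rewrite addnC; apply: Lg.
      by apply: mem_mxspan; exists t.
    + have [[t Lt vt]|none] :=
          classic (exists2 t, L (size t) & v *m wprod X t != 0).
        exists (v *m wprod X t) => //; exists (wprod X t) => //.
        by apply: mem_mxspan; exists t.
      pose N (y : 'rV_n) := forall t, L (size t) -> y *m wprod X t = 0.
      have kill y : N y.
        apply: (Xirr N).
        * split=> [t _|c x z Nx Nz t Lt]; first by rewrite mul0mx.
          by rewrite mulmxDl -scalemxAl Nx // Nz // scaler0 addr0.
        * move=> t x tg Nx s Ls; rewrite -mulmxA -wprod_cat Nx //.
          by rewrite size_cat tg; apply: Lg.
        * exists v => // t Lt; apply/eqP/negPn/negP => vt; apply: none.
          by exists t.
      have [t tl t0] := Xnil l0; case/eqP: t0.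
      rewrite -[wprod X t]mul1mx; apply/row_matrixP => i.
      by rewrite row_mul kill ?row0 ?tl.
elim: Sx trx => [|c y z [w Lw ->] _ IH]; first by rewrite mulmx0 mxtrace0 eqxx.
have [w0|] := eqVneq (\tr (u *m wprod X w)) 0; last by exists w.
by rewrite mulmxDr -scalemxAr mxtraceD mxtraceZ w0 mulr0 add0r.
Qed.

(** * Irreducible subquotients and signed traces *)

Lemma wprod_intertwine (K : fieldType) (I : Type) m n (F : 'M[K]_(m, n)) X Y w :
  (forall i : I, F *m X i = Y i *m F) -> F *m wprod X w = wprod Y w *m F.
Proof.
move=> FXY; elim: w => [|i w IH] /=; first by rewrite mulmx1 mul1mx.
by rewrite mulmxA FXY -mulmxA IH mulmxA.
Qed.

Lemma not_nonnilpotent (K : fieldType) (I : Type) n (X : I -> 'M[K]_n) :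
  ~ nonnilpotent X -> exists m, forall w, size w = m -> wprod X w = 0.
Proof.
move=> /not_all_ex_not [m H]; exists m => w wm; apply/eqP/negPn/negP => w0.
by apply: H; exists w.
Qed.

(** Induction on [n]: a proper nonzero stable subspace carries a family, and so does its quotient;
    were both nilpotent, the whole would be. The two hypotheses say that [P] passes to subspaces and
    to quotients. *)
Lemma exists_irreducible_subquotient (K : fieldType) (I : Type)
    (P : forall n, (I -> 'M[K]_n) -> Prop) :
  (forall m n (F : 'M_(m, n)) X Y, row_free F ->
     (forall i, F *m X i = Y i *m F) -> P n X -> P m Y) ->
  (forall m n (G : 'M_(n, m)) X Y, row_full G ->
     (forall i, X i *m G = G *m Y i) -> P n X -> P m Y) ->
  forall n (X : I -> 'M_n), P n X -> nonnilpotent X ->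
  exists m (Y : I -> 'M_m),
    [/\ P m Y, nonnilpotent Y & irreducible_words Y 1].
Proof.
move=> Psub Pquo n; have [N] := ubnP n; elim: N n => // N IHN n nN X PX Xnil.
have [|Xred] := classic (irreducible_words X 1); first by exists n, X.
have [S [Ssub Sst [v Sv v0] [v' nSv']]] : exists S, [/\ subspace S,
    (forall w v, size w = 1%N -> S v -> S (v *m wprod X w)),
    (exists2 v, S v & v != 0) & exists v, ~ S v].
  apply: NNPP => H; apply: Xred => S Ssub Sst Snz v; apply: NNPP => nSv.
  by apply: H; exists S; split=> //; exists v.
have [U SU] := subspace_mx Ssub.
have UX i : (U *m X i <= U)%MS.
  apply/row_subP => j; rewrite row_mul -SU -(wprod1 X i).
  by apply: Sst => //; rewrite SU row_sub.
have rkU : (\rank U < n)%N.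
  rewrite ltn_neqAle rank_leq_row andbT; apply/negP => fullU.
  by apply: nSv'; rewrite SU; apply: submx_full.
have rkU0 : (0 < \rank U)%N.
  rewrite lt0n mxrank_eq0; apply: contraNneq v0 => U0.
  by have := Sv; rewrite SU U0 submx0.
have [F [Y [FX freeF FU]]] :
    exists (F : 'M_(\rank U, n)) (Y : I -> 'M_(\rank U)),
    [/\ forall i, F *m X i = Y i *m F, row_free F & (U <= F)%MS].
  exists (row_base U), (fun i => row_base U *m X i *m pinvmx (row_base U)).
  rewrite row_base_free eq_row_base; split=> // i; rewrite mulmxKpV //.
  rewrite eq_row_base; apply: submx_trans (UX i).
  by apply: submxMr; rewrite eq_row_base.
(* The rows of [H] form a basis of the functionals vanishing on [U], so [H^T] is the projection to
   the quotient by [U]. *)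
pose q := \rank (kermx U^T).
have qE : q = (n - \rank U)%N by rewrite /q mxrank_ker mxrank_tr.
have [H [freeH HU kerH]] : exists H : 'M_(q, n),
    [/\ row_free H, H *m U^T = 0 & (kermx U^T <= H)%MS].
  exists (row_base (kermx U^T)); rewrite row_base_free eq_row_base; split=> //.
  by apply: sub_kermxP; rewrite eq_row_base.
pose Z i := (H *m (X i)^T *m pinvmx H)^T.
have HX i : X i *m H^T = H^T *m Z i.
  apply: trmx_inj; rewrite !trmx_mul !trmxK mulmxKpV //.
  apply: submx_trans kerH; apply/sub_kermxP.
  have [C UC] := submxP (UX i).
  by rewrite -mulmxA -trmx_mul UC trmx_mul mulmxA HU mul0mx.
have fullH : row_full H^T by rewrite /row_full mxrank_tr.
have kerU m (V : 'M_(m, n)) : V *m H^T = 0 -> (V <= U)%MS.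
  move=> /sub_kermxP /submx_trans; apply.
  have UH : (U <= kermx H^T)%MS.
    by apply/sub_kermxP/trmx_inj; rewrite trmx_mul trmxK HU trmx0.
  rewrite -(geq_leqif (mxrank_leqif_sup UH)) mxrank_ker mxrank_tr.
  by rewrite (eqP freeH) qE; move: rkU; lia.
have [Ynil|/not_nonnilpotent [m1 Y0]] := classic (nonnilpotent Y).
  by apply: IHN Ynil; [lia | exact: Psub FX PX].
have [Znil|/not_nonnilpotent [m2 Z0]] := classic (nonnilpotent Z).
  apply: IHN Znil; last exact: Pquo HX PX.
  by rewrite -/q; move: rkU rkU0; lia.
(* The first [m2] letters are zero on the quotient, so they map into [U], where the last [m1]
   letters are zero. *)
have [w wm] := Xnil (m2 + m1)%N.
rewrite -(cat_take_drop m2 w) wprod_cat => /eqP []; set w1 := take _ _.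
have w1m : size w1 = m2 by rewrite size_takel // wm leq_addr.
have /submxP [C ->] : (wprod X w1 <= F)%MS.
  apply: submx_trans FU; apply: kerU; apply: trmx_inj; rewrite trmx_mul trmxK.
  have /(congr1 trmx) : wprod X w1 *m H^T = H^T *m wprod Z w1.
    elim: w1 {w1m} => [|i s IH] /=; first by rewrite mul1mx mulmx1.
    by rewrite -mulmxA IH !mulmxA HX.
  by rewrite Z0 // mulmx0 trmx_mul trmxK.
rewrite -mulmxA (wprod_intertwine _ FX) Y0 ?mul0mx ?mulmx0 //.
by rewrite size_drop wm addKn.
Qed.

Lemma irreducible_words_mx (K : fieldType) (I : Type) n (X : I -> 'M[K]_n)
    (V : 'M_n) :
  irreducible_words X 1 -> (forall i, (V *m X i <= V)%MS) -> V != 0 ->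
  row_full V.
Proof.
move=> Xirr VX V0.
suff fullV (v : 'rV_n) : (v <= V)%MS.
  by rewrite -sub1mx; apply/row_subP => i; apply: fullV.
apply: (Xirr (fun v => (v <= V)%MS)).
- by split=> [|c x y Vx Vy]; rewrite ?sub0mx // addmx_sub // scalemx_sub.
- move=> [|i [|j w]] //= y _ Vy; rewrite mulmx1.
  exact: submx_trans (submxMr _ Vy) (VX i).
- apply: NNPP => none; case/eqP: V0; apply/row_matrixP => i; rewrite row0.
  apply/eqP/negPn/negP => Vi; apply: none.
  by exists (row i V); rewrite ?row_sub.
Qed.

(* Either the even words already act irreducibly, and then odd words have
   nonzero traces; or the space splits into two halves exchanged by every
   generator, and then the supertrace [\tr (u *m _)] is nonzero on even words. *)
Lemma exists_signed_trace (K : closedFieldType) (I : finType) n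
    (X : I -> 'M[K]_n) :
  irreducible_words X 1 -> nonnilpotent X ->
  forall M, exists w (u : 'M_n), [/\ (M < size w)%N,
    forall i, X i *m u = (-1) ^+ (size w).-1 *: (u *m X i) &
    \tr (u *m wprod X w) != 0].
Proof.
move=> Xirr Xnil M.
have [Xirr2|Xred2] := classic (irreducible_words X 2).
  have n0 : 1%:M != 0 :> 'M[K]_n.
    have [w _] := Xnil 0%N; apply: contraNneq => n0.
    by rewrite -[wprod X w]mul1mx n0 mul0mx.
  have [|||w [ow Mw] trw] := exists_wprod_mxtrace_neq0
      (L := fun l => odd l /\ (M < l)%N) Xirr2 Xnil _ _ _ n0.
  - by exists M.*2.+1; rewrite /= odd_double; split=> //; lia.
  - by move=> l [ol Ml]; rewrite oddD ol; split=> //; lia.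
  - move=> a b c [oa Ma] [ob Mb] [oc Mc].
    by rewrite !oddD oa ob oc; split=> //; lia.
  exists w, 1%:M; split=> // i; rewrite mulmx1 mul1mx -signr_odd.
  by case: (size w) ow => //= m /negbTE ->; rewrite scale1r.
have [S [Ssub Sst [v Sv v0] [v' nSv']]] : exists S, [/\ subspace S,
    (forall w v, size w = 2%N -> S v -> S (v *m wprod X w)),
    (exists2 v, S v & v != 0) & exists v, ~ S v].
  apply: NNPP => H; apply: Xred2 => S Ssub Sst Snz v; apply: NNPP => nSv.
  by apply: H; exists S; split=> //; exists v.
have [U SU] := subspace_mx Ssub.
have U0 : U != 0 by apply: contraNneq v0 => U0; rewrite -submx0 -U0 -SU.
have nfullU : ~~ row_full U.
  by apply/negP => fullU; apply: nSv'; rewrite SU submx_full.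
(* Generators map [U] into [V] and, by stability under words of length 2, [V] into [U]. So [U :&: V]
   and [U + V] are stable, and irreducibility makes the space the direct sum of [U] and [V]. *)
pose V := (\sum_i <<U *m X i>>)%MS.
have UX i : (U *m X i <= V)%MS by rewrite (sumsmx_sup i) // genmxE.
have VX i : (V *m X i <= U)%MS.
  rewrite sumsmxMr; apply/sumsmx_subP => j _.
  rewrite (eqmxMr _ (genmxE _)) -mulmxA; apply/row_subP => k.
  rewrite row_mul -SU -[X j *m X i]mulmx1 -mulmxA.
  by apply: (Sst [:: j; i]) => //; rewrite SU row_sub.
have UV0 : (U :&: V = 0)%MS.
  apply/eqP/negPn/negP => cap0; case/negP: nfullU.
  rewrite -sub1mx; apply: submx_trans (capmxSl U V); rewrite sub1mx.
  apply: (irreducible_words_mx Xirr) cap0 => i.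
  rewrite sub_capmx (submx_trans (submxMr _ (capmxSr _ _))) //.
  by rewrite (submx_trans (submxMr _ (capmxSl _ _))).
have fullUV : (1%:M <= U + V)%MS.
  rewrite sub1mx; apply: (irreducible_words_mx Xirr) => [i|].
    rewrite addsmxMr addsmx_sub (submx_trans (UX i)) ?addsmxSr //.
    by rewrite (submx_trans (VX i)) ?addsmxSl.
  apply: contraNneq U0 => UV; rewrite -submx0 -UV; exact: addsmxSl.
have eqUV (Q Q' : 'M_n) : U *m Q = U *m Q' -> V *m Q = V *m Q' -> Q = Q'.
  move=> UQ VQ; have /sub_addsmxP [[a b] /= E1] := fullUV.
  by rewrite -[Q]mul1mx -[Q']mul1mx E1 !mulmxDl -!mulmxA UQ VQ.
have [p [idU idV pp]] : exists p : 'M_n, [/\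
    forall W : 'M_n, (W <= U)%MS -> W *m p = W,
    forall W : 'M_n, (W <= V)%MS -> W *m p = 0 & p *m p = p].
  exists (proj_mx U V); split; last exact: proj_mx_proj.
    by move=> W WU; rewrite proj_mx_id.
  by move=> W WV; rewrite proj_mx_0.
have [Up Vp] := (idU U (submx_refl U), idV V (submx_refl V)).
pose p' := 1%:M - p.
have Xp i : X i *m p = p' *m X i.
  apply: eqUV; rewrite !mulmxA /p' mulmxBr mulmx1 ?Up ?Vp ?subrr ?subr0 ?mul0mx.
    exact: idV.
  exact: idU.
have Xp' i : X i *m p' = p *m X i.
  by rewrite /p' mulmxBr mulmx1 Xp mulmxBl mul1mx opprB addrC subrK.
have Wp w : wprod X w *m p = (if odd (size w) then p' else p) *m wprod X w.
  elim: w => [|i w IH] /=; first by rewrite mulmx1 mul1mx.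
  by rewrite -mulmxA IH !mulmxA; case: odd; rewrite /= ?Xp ?Xp'.
have u0 : p - p' != 0.
  apply: contraNneq U0 => /subr0_eq pE.
  by rewrite -Up pE mulmxBr mulmx1 Up subrr.
have [|||w Mw trw] := exists_wprod_mxtrace_neq0
    (L := fun l => (M < l)%N) Xirr Xnil _ _ _ u0.
- by exists M.+1.
- by move=> l Ml; lia.
- by move=> a b c *; lia.
exists w, (p - p'); split=> // i.
(* Odd words exchange [U] and [V], so their trace against [p - p'] is zero: the word found is
   even. *)
have ow : odd (size w) = false.
  apply/negP => ow; case/negP: trw.
  have trp : \tr (p *m wprod X w) = 0.
    rewrite -pp -mulmxA mxtrace_mulC -mulmxA Wp ow mulmxA mulmxBr mulmx1 pp.
    by rewrite subrr mul0mx mxtrace0.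
  rewrite mulmxBl mxtraceD raddfN /= trp.
  by rewrite (_ : \tr (p' *m _) = 0) ?oppr0 ?addr0 //
    -trp -[RHS]mxtrace_mulC Wp ow.
have -> : (-1) ^+ (size w).-1 = -1 :> K.
  by case: (size w) ow Mw => //= m /negbFE om _; rewrite -signr_odd om.
by rewrite mulmxBr Xp Xp' -mulmxBl scaleN1r -mulNmx opprB.
Qed.

(** * Eigenvalues and balanced families *)

Lemma exists_eigenvalue_neq0 (K : closedFieldType) n (x : 'M[K]_n) :
  \tr x != 0 -> exists (v : 'rV_n) c, [/\ v != 0, c != 0 & v *m x = c *: v].
Proof.
case: n x => [|n] x; first by rewrite /mxtrace big_ord0 eqxx.
move=> trx; have [r px] := closed_field_poly_normal (char_poly x).
move: px; rewrite (monicP (char_poly_monic x)) scale1r => px.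
have [/hasP [c cr c0]|/hasPn rall] := boolP (has (fun z => z != 0) r).
  have : eigenvalue x c.
    by rewrite eigenvalue_root_char px root_prod_XsubC.
  by move=> /eigenvalueP [v vx v0]; exists v, c.
(* If all eigenvalues are zero, the characteristic polynomial is a power of ['X] and its trace
   coefficient vanishes. *)
have pX : char_poly x = 'X^(size r).
  rewrite px (eq_big_seq (fun=> 'X)) ?big_const_seq ?count_predT ?iter_mulr_1 //.
  by move=> z /rall /negPn /eqP ->; rewrite subr0.
have szr : size r = n.+1.
  by apply: succn_inj; rewrite -(size_polyXn K) -pX size_char_poly.
have := char_poly_trace x (ltn0Sn n); rewrite pX szr coefXn /= ltn_eqF //.
by move=> /eqP; rewrite eq_sym oppr_eq0 (negPf trx).
Qed.

(* With [X (j, b) = θ_j(e_b^* )] this says [θ_i(f a) θ_j(g) = θ_i(f) θ_j(a g)] for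
   [f, g] in DA and [a] in A. *)
Definition balanced (K : fieldType) (A : fdalg K) (J : Type) n
    (X : J * 'I_(fd_dim A) -> 'M[K]_n) : Prop :=
  forall i j a b c,
    \sum_k fd_mul A a k 0 b *: (X (i, k) *m X (j, c)) =
    \sum_k fd_mul A k a 0 c *: (X (i, b) *m X (j, k)).

(** Both sides of the relation are sums of products of two generators, so an intertwiner moves
    across them and, being injective or surjective, cancels. *)
Lemma exists_irreducible_balanced (K : fieldType) (A : fdalg K) (J : Type) n
    (X : J * 'I_(fd_dim A) -> 'M[K]_n) :
  balanced X -> nonnilpotent X ->
  exists m (Y : J * 'I_(fd_dim A) -> 'M[K]_m),
    [/\ balanced Y, nonnilpotent Y & irreducible_words Y 1].
Proof.
move=> Xbal Xnil.
apply: (@exists_irreducible_subquotient _ _ (fun n X => @balanced K A J n X))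
    Xbal Xnil => {X n}.
- move=> m n F X Y freeF FX Xbal i j a b c; apply: (row_free_inj freeF).
  rewrite !mulmx_suml.
  under eq_bigr do rewrite -scalemxAl -mulmxA -FX mulmxA -FX -mulmxA scalemxAr.
  under [in RHS]eq_bigr do
    rewrite -scalemxAl -mulmxA -FX mulmxA -FX -mulmxA scalemxAr.
  by rewrite -!mulmx_sumr Xbal.
- move=> m n G X Y fullG XG Xbal i j a b c; apply: (row_full_inj fullG).
  rewrite !mulmx_sumr.
  under eq_bigr do rewrite -scalemxAr mulmxA -XG -mulmxA -XG mulmxA scalemxAl.
  under [in RHS]eq_bigr do
    rewrite -scalemxAr mulmxA -XG -mulmxA -XG mulmxA scalemxAl.
  by rewrite -!mulmx_suml Xbal.
Qed.

Lemma tensmx_sumZl (R : comPzRingType) (I : finType) m n p q (c : I -> R)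
    (A : I -> 'M[R]_(m, n)) (B : 'M_(p, q)) :
  (\sum_i c i *: A i) *t B = \sum_i c i *: (A i *t B).
Proof.
apply/matrixP => k l; rewrite !mxE !summxE big_distrl /=.
by apply: eq_bigr => i _; rewrite !mxE mulrA.
Qed.

(* A non-nilpotent word x_(j_1,b_1) ... x_(j_p,b_p) yields a single family:
   Y_b sends the r-th of p copies of the space to the next one by X_(j_r,b). *)
Lemma exists_single_balanced (K : closedFieldType) (A : fdalg K) (J : Type) n
    (X : J * 'I_(fd_dim A) -> 'M[K]_n) :
  balanced X -> nonnilpotent X ->
  exists m (Y : unit * 'I_(fd_dim A) -> 'M[K]_m), balanced Y /\ nonnilpotent Y.
Proof.
move=> Xbal0 Xnil0.
have [{Xbal0 Xnil0}n' [{}X [Xbal Xnil Xirr]]] :=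
  exists_irreducible_balanced Xbal0 Xnil0.
move: n' X Xbal Xnil Xirr => {}n X Xbal Xnil Xirr.
have n0 : 1%:M != 0 :> 'M[K]_n.
  have [w _] := Xnil 0%N; apply: contraNneq => n0.
  by rewrite -[wprod X w]mul1mx n0 mul0mx.
(* A word of nonzero trace has a nonzero eigenvalue, so all its powers are nonzero; nonnilpotency by
   itself only says that each length has some nonzero word. *)
have [|||w w0 trw] := exists_wprod_mxtrace_neq0
    (L := fun l => (0 < l)%N) Xirr Xnil _ _ _ n0.
- by exists 1%N.
- by move=> l l0; lia.
- by move=> a b c *; lia.
move: trw; rewrite mul1mx => /exists_eigenvalue_neq0 [v [c [v0 c0 vw]]].
case: w w0 vw => // x0 w' _; set w := x0 :: w'; set p := size w' => vw.
(* Positions are taken modulo the length [p.+1] of the word, so that its last letter leads back to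
   the first copy. *)
pose e k : 'rV[K]_p.+1 := delta_mx 0 (inZp k).
pose Y (x : unit * 'I_(fd_dim A)) :=
  \sum_(r < p.+1) X ((nth x0 w r).1, x.2) *t delta_mx r (inZp r.+1 : 'I_p.+1).
exists (n * p.+1)%N, Y; split.
  move=> i j a b d; rewrite /Y /=.
  (* The second tensor factor is independent of the basis index summed over, so the relation reduces
     to that of [X] for each pair [r], [s]; this is why [balanced] allows two different indices in
     [J]. *)
  pose E (r s : 'I_p.+1) : 'M[K]_p.+1 :=
    delta_mx r (inZp r.+1) *m delta_mx s (inZp s.+1).
  have YY (f : 'I_(fd_dim A) -> K) (k l : 'I_(fd_dim A) -> 'I_(fd_dim A)) :
      \sum_t f t *: (Y (i, k t) *m Y (j, l t)) =
      \sum_(r < p.+1) \sum_(s < p.+1) (\sum_t f t *: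
        (X ((nth x0 w r).1, k t) *m X ((nth x0 w s).1, l t))) *t E r s.
    under eq_bigr do rewrite mulmx_suml scaler_sumr.
    rewrite exchange_big; apply: eq_bigr => r _ /=.
    under eq_bigr do rewrite mulmx_sumr scaler_sumr.
    rewrite exchange_big; apply: eq_bigr => s _ /=.
    by rewrite tensmx_sumZl; apply: eq_bigr => t _; rewrite tensmx_mul.
  rewrite (YY _ id (fun=> d)) (YY _ (fun=> b) id).
  by apply: eq_bigr => r _; apply: eq_bigr => s _; rewrite Xbal.
have eS (k : nat) : inZp (inZp k : 'I_p.+1).+1 = inZp k.+1 :> 'I_p.+1.
  by apply: val_inj; rewrite /= -addn1 modnDml addn1.
have eY m (a : 'M_(m, n)) k b :
    (a *t e k) *m Y (tt, b) = (a *m X ((nth x0 w (k %% p.+1)).1, b)) *t e k.+1.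
  rewrite mulmx_sumr (bigD1 (inZp k)) //= big1 ?addr0 => [|r rk].
    by rewrite tensmx_mul /= mul_delta_mx eS.
  by rewrite tensmx_mul mul_delta_mx_cond eq_sym (negPf rk) tensmx0.
have eW m (a : 'M_(m, n)) s k : s = drop k w -> (k <= p.+1)%N ->
    (a *t e k) *m wprod Y [seq (tt, x.2) | x <- s] = (a *m wprod X s) *t e 0%N.
  elim: s k a => [|x s IH] k a sw kp /=.
    have -> : k = p.+1.
      by apply/eqP; rewrite eqn_leq kp -subn_eq0 -(size_drop k w) -sw.
    rewrite !mulmx1; congr (_ *t delta_mx _ _).
    by apply: val_inj; rewrite /= modnn mod0n.
  have kp1 : (k < p.+1)%N.
    rewrite ltn_neqAle kp andbT; apply/eqP => kE.
    by move: sw; rewrite kE drop_oversize.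
  move: sw; rewrite (drop_nth x0) // => -[-> sw].
  by rewrite mulmxA eY modn_small // IH // -?mulmxA -?surjective_pairing.
have [W [szW vW]] : exists W, size W = p.+1 /\
    (v *t e 0%N) *m wprod Y W = c *: (v *t e 0%N).
  exists [seq (tt, x.2) | x <- w]; split; first exact: size_map.
  rewrite (eW _ _ w) ?drop0 // vw; apply/matrixP => i j.
  by rewrite !mxE mulrA.
have vY k :
    (v *t e 0%N) *m wprod Y (flatten (nseq k W)) = c ^+ k *: (v *t e 0%N).
  elim: k => [|k IH] /=; first by rewrite mulmx1 scale1r.
  by rewrite wprod_cat mulmxA vW -scalemxAl IH scalerA -exprS.
apply: nonnilpotentS => k; exists (flatten (nseq k W)).
  by rewrite size_flatten /shape map_nseq sumn_nseq szW leq_pmull.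
apply: contraNneq (expf_neq0 k c0) => W0.
have [i vi] : exists i, v 0 i != 0 by apply/rV0Pn.
move: (vY k); rewrite W0 mulmx0 => /matrixP.
move=> /(_ (mxtens_index (0, 0)) (mxtens_index (i, inZp 0))).
rewrite mxE [RHS]mxE tensmxE !mxE !eqxx mulr1 => /eqP; rewrite eq_sym mulf_eq0.
by rewrite (negPf vi) orbF.
Qed.

(** * The balanced family of a selfinjective algebra *)

Lemma sum_mxtens (V : nmodType) m n (F : 'I_(m * n) -> V) :
  \sum_q F q = \sum_i \sum_j F (mxtens_index (i, j)).
Proof.
rewrite pair_big /= (reindex (@mxtens_index m n)) /=.
  by apply: eq_bigr => -[i j].
by exists (@mxtens_unindex m n) => q _; rewrite (mxtens_indexK, mxtens_unindexK).
Qed.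

Lemma fdmulE (K : fieldType) (A : fdalg K) (x y : 'rV_(fd_dim A)) k :
  fdmul x y 0 k = \sum_i \sum_j x 0 i * y 0 j * fd_mul A i j 0 k.
Proof.
rewrite summxE; apply: eq_bigr => i _; rewrite summxE.
by apply: eq_bigr => j _; rewrite mxE.
Qed.

Lemma fdmul_delta (K : fieldType) (A : fdalg K) i j :
  @fdmul K A (delta_mx 0 i) (delta_mx 0 j) = fd_mul A i j.
Proof.
rewrite /fdmul (bigD1 i) //= [X in _ + X]big1 ?addr0 => [|k ki]; last first.
  by rewrite big1 // => l _; rewrite !mxE (negPf ki) mul0r scale0r.
rewrite (bigD1 j) //= big1 ?addr0 => [|k kj]; last first.
  by rewrite !mxE (negPf kj) mulr0 scale0r.
by rewrite !mxE !eqxx mulr1 scale1r.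
Qed.

Section StructureConstants.
Variables (K : fieldType) (A : fdalg K).
Hypothesis algA : is_fdalg A.
Local Notation d := (fd_dim A).
Local Notation c i j k := (fd_mul A i j 0 k).

Lemma fd_mul_assoc i j l m :
  \sum_k c i j k * c k l m = \sum_k c j l k * c i k m.
Proof.
have [_ assoc _ _] := algA.
have := assoc (delta_mx 0 i) (delta_mx 0 j) (delta_mx 0 l).
rewrite !fdmul_delta => /rowP /(_ m); rewrite !fdmulE => E.
transitivity (\sum_k \sum_j0 c i j k * (delta_mx 0 l : 'rV_d) 0 j0 * c k j0 m).
  apply: eq_bigr => k _; rewrite (bigD1 l) //= big1 ?addr0 => [|t tl].
    by rewrite !mxE !eqxx mulr1.
  by rewrite !mxE (negPf tl) mulr0 mul0r.
rewrite {}E (bigD1 i) //= [X in _ + X]big1 ?addr0 => [|t ti].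
  by apply: eq_bigr => k _; rewrite !mxE !eqxx mul1r.
by rewrite big1 // => k _; rewrite !mxE (negPf ti) !mul0r.
Qed.

Lemma fd_one_mull j k : \sum_i fd_one A 0 i * c i j k = (j == k)%:R.
Proof.
have [_ _ unitl _] := algA.
have := unitl (delta_mx 0 j) => /rowP /(_ k); rewrite fdmulE !mxE eqxx eq_sym => <-.
apply: eq_bigr => i _; rewrite (bigD1 j) //= big1 ?addr0 => [|t tj].
  by rewrite !mxE !eqxx mulr1.
by rewrite !mxE (negPf tj) mulr0 mul0r.
Qed.

Lemma fd_one_mulr i k : \sum_j fd_one A 0 j * c i j k = (i == k)%:R.
Proof.
have [_ _ _ unitr] := algA.
have := unitr (delta_mx 0 i) => /rowP /(_ k); rewrite fdmulE !mxE eqxx eq_sym => <-.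
rewrite exchange_big; apply: eq_bigr => j _ /=.
rewrite (bigD1 i) //= big1 ?addr0 => [|t tj].
  by rewrite !mxE !eqxx mul1r.
by rewrite !mxE (negPf tj) !mul0r.
Qed.

Lemma is_rmod_basis m (rho : 'I_d -> 'M[K]_m) :
  \sum_a fd_one A 0 a *: rho a = 1%:M ->
  (forall a b, rho a *m rho b = \sum_k c a b k *: rho k) -> is_rmod rho.
Proof.
move=> rho1 rhoM; split=> // x y.
rewrite /act mulmx_suml; under [RHS]eq_bigr do rewrite fdmulE scaler_suml.
rewrite exchange_big; apply: eq_bigr => a _ /=; rewrite mulmx_sumr.
under [RHS]eq_bigr do rewrite scaler_suml.
rewrite exchange_big; apply: eq_bigr => b _ /=.
rewrite -scalemxAl -scalemxAr scalerA rhoM scaler_sumr.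
by apply: eq_bigr => k _; rewrite scalerA.
Qed.

Lemma is_rmod_reg : is_rmod (@reg_rmod K A).
Proof.
apply: is_rmod_basis => [|a b]; apply/matrixP => i j; rewrite !mxE ?summxE.
  by rewrite -fd_one_mulr; apply: eq_bigr => a _; rewrite !mxE.
under eq_bigr do rewrite !mxE.
by rewrite fd_mul_assoc; apply: eq_bigr => k _; rewrite !mxE.
Qed.

(** The right module [DA], [(f a)(x) = f(a x)], in the dual basis. *)
Definition dual_rmod (a : 'I_d) : 'M[K]_d := \matrix_(b, k) c a k b.

Lemma is_rmod_dual_sum m : is_rmod (fun a => dual_rmod a *t (1%:M : 'M_m)).
Proof.
apply: is_rmod_basis => [|a b].
  rewrite -tensmx_sumZl (_ : \sum_i _ = 1%:M).
    apply/matrixP => q r.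
    case: (mxtens_indexP q) => i j; case: (mxtens_indexP r) => k l.
    rewrite tensmxE !mxE (can_eq (@mxtens_indexK _ _)) xpair_eqE.
    by rewrite -natrM mulnb.
  apply/matrixP => i j; rewrite summxE mxE eq_sym -fd_one_mull.
  by apply: eq_bigr => a _; rewrite !mxE.
rewrite tensmx_mul mulmx1 -tensmx_sumZl; congr (_ *t _).
apply/matrixP => i j; rewrite !mxE summxE.
under eq_bigr do rewrite !mxE mulrC.
by rewrite -fd_mul_assoc; apply: eq_bigr => k _; rewrite !mxE.
Qed.

(* [g] splits the embedding [x |-> (e_j^* x)_j] of A into DA^d; the generators
   are the maps [x |-> g_j (x e_b^* )] of A. *)
Lemma exists_balanced_of_selfinjective : selfinjective A ->
  exists X : 'I_d * 'I_d -> 'M[K]_d, balanced X /\ nonnilpotent X.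
Proof.
move=> injA.
pose i : 'M[K]_(d, d * d) :=
  \matrix_(a, q) c a (mxtens_unindex q).1 (mxtens_unindex q).2.
have freei : row_free i.
  (* The inverse evaluates functionals at 1: [(e_j^* x)(1)] is the [j]-th coordinate of [x]. *)
  apply/row_freeP; exists (\matrix_(q, m) (fd_one A 0 (mxtens_unindex q).1 *
     ((mxtens_unindex q).2 == m)%:R)).
  apply/matrixP => a m; rewrite !mxE sum_mxtens -fd_one_mulr.
  apply: eq_bigr => k _; rewrite (bigD1 m) // big1 => [|j /andP [_ jm]].
    by rewrite !mxE mxtens_indexK /= eqxx mulr1 mulrC addr0.
  by rewrite !mxE mxtens_indexK /= (negPf jm) !mulr0.
have [g [ghom ig]] : exists g, is_hom (fun a => dual_rmod a *t (1%:M : 'M_d))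
    (@reg_rmod K A) g /\ i *m g = 1%:M.
  apply: injA freei _ _; [exact: is_rmod_reg | exact: is_rmod_dual_sum | | ].
    move=> a; apply/matrixP => x q; case: (mxtens_indexP q) => k j.
    rewrite !mxE sum_mxtens.
    under eq_bigr do rewrite !mxE mxtens_indexK /=.
    rewrite fd_mul_assoc; apply: eq_bigr => t _.
    rewrite (bigD1 j) //= big1 ?addr0 => [|s sj].
      by rewrite tensmxE !mxE mxtens_indexK eqxx mulr1 mulrC.
    by rewrite tensmxE !mxE (negPf sj) !mulr0.
  by move=> a; rewrite mulmx1 mul1mx.
(* The component [g_j : DA -> A] of the splitting; [DG] is its right linearity. *)
pose G j : 'M[K]_d := \matrix_(k, m) g (mxtens_index (k, j)) m.
have DG a j : dual_rmod a *m G j = G j *m reg_rmod a.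
  have /matrixP gE := ghom a.
  apply/matrixP => k m; have := gE (mxtens_index (k, j)) m.
  rewrite !mxE sum_mxtens => E.
  transitivity (\sum_t g (mxtens_index (k, j)) t * (@reg_rmod K A a) t m).
    rewrite -E; apply: eq_bigr => t _.
    rewrite (bigD1 j) //= big1 ?addr0 => [|s sj].
      by rewrite tensmxE !mxE eqxx mulr1.
    by rewrite tensmxE !mxE eq_sym (negPf sj) !mulr0 mul0r.
  by apply: eq_bigr => t _; rewrite !mxE.
(* The map [x |-> x e_b^*] from [A] to [DA], with [(x f)(y) = f(y x)]. Then [LD] says
   [(x f) a = x (f a)], and [RL] says [(x a) f = x (a f)]. *)
pose L b : 'M[K]_d := \matrix_(x, k) c k x b.
have LD a b : L b *m dual_rmod a = \sum_k c a k b *: L k.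
  apply/matrixP => x y; rewrite mxE summxE.
  under [RHS]eq_bigr do rewrite !mxE mulrC.
  by rewrite -fd_mul_assoc; apply: eq_bigr => k _; rewrite !mxE mulrC.
have RL a b : reg_rmod a *m L b = \sum_k c k a b *: L k.
  apply/matrixP => x y; rewrite mxE summxE.
  under [RHS]eq_bigr do rewrite !mxE mulrC.
  by rewrite fd_mul_assoc; apply: eq_bigr => k _; rewrite !mxE.
pose X (q : 'I_d * 'I_d) := L q.2 *m G q.1.
exists X; split.
  move=> j j' a b b'; rewrite /X /=.
  transitivity (L b *m dual_rmod a *m G j *m L b' *m G j').
    by rewrite LD !mulmx_suml; apply: eq_bigr => k _; rewrite -!scalemxAl !mulmxA.
  rewrite -(mulmxA (L b)) DG -!mulmxA [reg_rmod a *m _]mulmxA RL.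
  rewrite mulmx_suml !mulmx_sumr.
  by apply: eq_bigr => k _; rewrite -scalemxAl -!scalemxAr !mulmxA.
(* [T] sends [x] to the sum of the [g_j(x e_j^* )], so it fixes 1 because [g] splits [i]. No power
   of [T] is then zero, and expanding the power gives a nonzero word of each length. *)
pose T := \sum_j X (j, j).
have oneT : fd_one A *m T = fd_one A.
  rewrite -[RHS]mulmx1 -ig mulmxA mulmx_sumr; apply/rowP => m.
  rewrite summxE [RHS]mxE sum_mxtens exchange_big /=; apply: eq_bigr => j _.
  rewrite mulmxA mxE; apply: eq_bigr => k _; rewrite [in RHS]mxE !mxE; congr (_ * _).
  transitivity ((k == j)%:R : K); [rewrite -fd_one_mulr | rewrite -fd_one_mull];
    by apply: eq_bigr => a _; rewrite !mxE ?mxtens_indexK.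
have iterT m (v : 'rV_d) : (forall w, size w = m -> v *m wprod X w = 0) ->
    iter m (mulmxr T) v = 0.
  elim: m v => [|m IH] v vX; first by rewrite -(vX [::]) //= mulmx1.
  rewrite iterSr IH // => w wm; rewrite /= /T mulmx_sumr mulmx_suml big1 // => j _.
  by rewrite -mulmxA (vX ((j, j) :: w)) //= wm.
move=> m; apply: NNPP => none.
have one0 : fd_one A = 0.
  rewrite -[RHS](iterT m (fd_one A)) ?iter_fix //= => w wm.
  have [->|w0] := eqVneq (wprod X w) 0; first by rewrite mulmx0.
  by case: none; exists w.
have [d0 _ _ _] := algA; have := fd_one_mull (Ordinal d0) (Ordinal d0).
rewrite big1 ?eqxx => [/eqP|a _]; first by rewrite eq_sym oner_eq0.
by rewrite one0 mxE mul0r.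
Qed.
End StructureConstants.

(** * Trace functionals on Hochschild chains *)

Section TraceCocycle.
Variables (K : fieldType) (A : fdalg K) (n : nat).
Variables (Y : unit * 'I_(fd_dim A) -> 'M[K]_n) (u : 'M[K]_n) (e : K).
Hypothesis Ybal : balanced Y.
Hypothesis Yu : forall b, Y b *m u = e *: (u *m Y b).
Local Notation d := (fd_dim A).
Local Notation c i j k := (fd_mul A i j 0 k).

(** Extending by zero on [A] makes the functional see only tensors of elements of [DA]. *)
Definition triv_act (i : 'I_(d + d)) : 'M[K]_n :=
  match split i with inl _ => 0 | inr b => Y (tt, b) end.

(* [L] and [R] separate the products A * DA from DA * A, so that a face of type
   [R] cancels against the next face of type [L] and the boundary telescopes. *)
Definition triv_actl (i j : 'I_(d + d)) : 'M[K]_n :=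
  match split i, split j with
  | inl a, inr b => \sum_k c k a b *: Y (tt, k)
  | _, _ => 0
  end.

Definition triv_actr (i j : 'I_(d + d)) : 'M[K]_n :=
  match split i, split j with
  | inr b, inl a => \sum_k c a k b *: Y (tt, k)
  | _, _ => 0
  end.

Local Notation Z := triv_act.
Local Notation L := triv_actl.
Local Notation R := triv_actr.

Lemma triv_act_lshift a : Z (lshift d a) = 0.
Proof. by rewrite /Z -[lshift d a]/(unsplit (inl a)) unsplitK. Qed.

Lemma triv_act_rshift b : Z (rshift d b) = Y (tt, b).
Proof. by rewrite /Z -[rshift d b]/(unsplit (inr b)) unsplitK. Qed.

Lemma triv_act_mul i j : \sum_k triv_mul i j 0 k *: Z k = L i j + R i j.
Proof.
rewrite big_split_ord /= big1 ?add0r => [|k _]; last first.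
  by rewrite triv_act_lshift scaler0.
under eq_bigr do rewrite triv_act_rshift.
rewrite /triv_mul /L /R; case: (split i) (split j) => [a|b] [a'|b'].
- by rewrite big1 ?addr0 // => k _; rewrite row_mxEr mxE scale0r.
- by rewrite addr0; apply: eq_bigr => k _; rewrite row_mxEr mxE.
- by rewrite add0r; apply: eq_bigr => k _; rewrite row_mxEr mxE.
- by rewrite big1 ?addr0 // => k _; rewrite mxE scale0r.
Qed.

(** Both sides vanish unless [i], [j], [k] lie in [DA], [A], [DA]; then this is
    [θ(f a) θ(g) = θ(f) θ(a g)]. *)
Lemma triv_act_assoc i j k : R i j *m Z k = Z i *m L j k.
Proof.
rewrite /R /Z /L; case: (split i) (split j) (split k) => [a|b] [a'|b'] [a''|b''];
  rewrite ?mul0mx ?mulmx0 // mulmx_suml mulmx_sumr.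
under eq_bigr do rewrite -scalemxAl.
by under [RHS]eq_bigr do rewrite -scalemxAr.
Qed.

Lemma triv_act_comm i : Z i *m u = e *: (u *m Z i).
Proof. by rewrite /Z; case: split => * //; rewrite mul0mx mulmx0 scaler0. Qed.

Lemma triv_actr_comm i j : R i j *m u = e *: (u *m R i j).
Proof.
rewrite /R; case: (split i) => ?; case: (split j) => ?;
  rewrite ?mul0mx ?mulmx0 ?scaler0 //.
rewrite mulmx_suml mulmx_sumr scaler_sumr; apply: eq_bigr => k _.
by rewrite -scalemxAl Yu -scalemxAr !scalerA mulrC.
Qed.

Lemma mxtrace_rot (T P : 'M[K]_n) :
  T *m u = e *: (u *m T) -> \tr (u *m P *m T) = e * \tr (u *m T *m P).
Proof. by move=> Tu; rewrite mxtrace_mulC mulmxA Tu -scalemxAl mxtraceZ. Qed.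

(** Bringing the last letter [l] to the front costs [e]; there [Z l *m L x y] is traded for
    [R l x *m Z y], which contains the product of the cyclic face. *)
Lemma trace_cocycle_rotl x y l z :
  \tr (u *m L x y *m wprod Z (rcons z l)) =
  e * \tr (u *m R l x *m wprod Z (y :: z)).
Proof.
rewrite -cats1 wprod_cat wprod1 mulmxA -(mulmxA u) mxtrace_rot; last first.
  exact: triv_act_comm.
by rewrite -!mulmxA [Z l *m (L x y *m _)]mulmxA -triv_act_assoc /= !mulmxA.
Qed.

(** [R y l] comes to the front at the cost of [e], [R y l *m Z x] is traded for [Z y *m L l x], and
    returning [Z y] to the end undoes the factor. *)
Lemma trace_cocycle_rotr x y l z :
  \tr (u *m wprod Z (x :: z) *m R y l) =
  \tr (u *m L l x *m wprod Z (rcons z y)).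
Proof.
rewrite mxtrace_rot; last exact: triv_actr_comm.
rewrite /= -!mulmxA [R y l *m (Z x *m _)]mulmxA triv_act_assoc.
rewrite -cats1 wprod_cat wprod1.
rewrite [RHS](_ : _ = \tr (u *m (L l x *m wprod Z z) *m Z y)).
  by rewrite mxtrace_rot ?triv_act_comm // !mulmxA.
by rewrite !mulmxA.
Qed.

(** The functional on the [i]-th face of [z], with [D] in place of the image of the product; [L] and
    [R] isolate its two halves. *)
Definition trace_face (D : 'I_(d + d) -> 'I_(d + d) -> 'M[K]_n) x0 z i : K :=
  \tr (u *m (wprod Z (take i z) *m D (nth x0 z i) (nth x0 z i.+1) *m
             wprod Z (drop i.+2 z))).

Lemma trace_face_shift x0 z i : (i.+2 < size z)%N ->
  trace_face R x0 z i = trace_face L x0 z i.+1.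
Proof.
move=> iz; rewrite /trace_face (drop_nth x0 iz) (take_nth x0) 1?ltnW 1?ltnW //.
rewrite -cats1 wprod_cat wprod1 /=.
rewrite -!(mulmxA (wprod Z (take i z))) [R _ _ *m (Z _ *m _)]mulmxA.
by rewrite triv_act_assoc !mulmxA.
Qed.

Lemma alternating_telescope (V : pzRingType) (f g : nat -> V) m :
  (forall i, (i < m)%N -> g i = f i.+1) ->
  \sum_(i < m.+1) (-1) ^+ i * (f i + g i) = f 0%N + (-1) ^+ m * g m.
Proof.
elim: m => [|m IH] fg; first by rewrite big_ord1 !mul1r.
rewrite big_ord_recr /= IH => [|i im]; last by apply: fg; rewrite ltnS ltnW.
by rewrite fg // mulrDr exprS mulN1r !mulNr addrA addrK.
Qed.

(** The faces other than the cyclic one telescope to the [L] half of the first and the [R] half of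
    the last. The rotations turn these into the [R] and [L] halves of the cyclic face, and the
    choice of [e] makes both signs opposite to that of the cyclic face. *)
Lemma trace_boundary x0 z m : size z = m.+3 -> e = (-1) ^+ m.+1 ->
  \sum_(i < m.+2) (-1) ^+ i * trace_face (fun i j => L i j + R i j) x0 z i +
  (-1) ^+ m.+2 * \tr (u *m ((L (nth x0 z m.+2) (nth x0 z 0) +
     R (nth x0 z m.+2) (nth x0 z 0)) *m wprod Z (take m.+1 (behead z)))) = 0.
Proof.
move=> zm eE.
have -> :
    \sum_(i < m.+2) (-1) ^+ i * trace_face (fun i j => L i j + R i j) x0 z i =
    \sum_(i < m.+2) (-1) ^+ i * (trace_face L x0 z i + trace_face R x0 z i).
  apply: eq_bigr => i _; congr (_ * _).
  by rewrite /trace_face mulmxDr mulmxDl mulmxDr mxtraceD.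
rewrite (alternating_telescope (f := trace_face L x0 z)) => [|i im]; last first.
  by apply: trace_face_shift; rewrite zm !ltnS.
case: z zm => // x z; case/lastP: z => // z l; rewrite /= size_rcons => -[zm].
rewrite nth_rcons zm ltnn eqxx -cats1 takel_cat ?zm // take_oversize ?zm //.
have -> : trace_face L x0 (x :: z ++ [:: l]) 0 = e * \tr (u *m R l x *m wprod Z z).
  case: z zm => // y z _; rewrite /trace_face /= cats1 drop0 mul1mx mulmxA.
  exact: trace_cocycle_rotl.
have -> : trace_face R x0 (x :: z ++ [:: l]) m.+1 = \tr (u *m L l x *m wprod Z z).
  case/lastP: z zm => // z y; rewrite size_rcons => -[zm].
  rewrite /trace_face /= cats1 drop_oversize ?size_rcons ?zm // mulmx1.
  rewrite -trace_cocycle_rotr !nth_rcons !size_rcons zm ltnSn ltnn eqxx ltnn eqxx.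
  by rewrite -!cats1 -catA takel_cat ?zm // take_oversize ?zm // !mulmxA.
rewrite mulmxDl mulmxDr mxtraceD !mulmxA eE [(-1) ^+ m.+2]exprS; ring.
Qed.

End TraceCocycle.

(** Only the value [t i] is free. This turns a sum over all target tensors of a face into the
    expansion of the one product it contains. *)
Lemma sum_single_position (K : pzRingType) m (T : finType) (i : 'I_m)
    (r : 'I_m -> T) (P : {ffun 'I_m -> T} -> bool) (g : T -> K)
    (f : {ffun 'I_m -> T} -> K) :
  (forall t, P t = [forall j, (j != i) ==> (t j == r j)]) ->
  \sum_t (P t)%:R * g (t i) * f t =
  \sum_k g k * f [ffun j => if j == i then k else r j].
Proof.
move=> PE; rewrite (partition_big (fun t : {ffun 'I_m -> T} => t i) xpredT) //=.
apply: eq_bigr => k _.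
have ri : [ffun j => if j == i then k else r j] i = k by rewrite ffunE eqxx.
rewrite (bigD1 [ffun j => if j == i then k else r j]) ?ri //= big1 ?addr0.
  rewrite PE (_ : [forall j, _]) ?mul1r //; apply/forallP => j.
  by apply/implyP => ji; rewrite ffunE (negPf ji).
move=> t /andP [/eqP ti tr]; rewrite PE (_ : [forall j, _] = false) ?mul0r //.
apply: contraNF tr => /forallP tr; apply/eqP/ffunP => j; rewrite ffunE.
by case: eqP => [->|/eqP ji] //; apply/eqP/(implyP (tr j)).
Qed.

(** * Basis tensors as sequences *)

Section Chains.
Variables (K : fieldType) (B : fdalg K).

Definition chain_seq m (t : hchain B m) : seq 'I_(fd_dim B) :=
  mkseq (fun j => t (inord j)) m.+1.
Arguments chain_seq : simpl never.

Lemma size_chain_seq m (t : hchain B m) : size (chain_seq t) = m.+1.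
Proof. exact: size_mkseq. Qed.

Lemma nth_chain_seq m (t : hchain B m) x0 j :
  (j < m.+1)%N -> nth x0 (chain_seq t) j = t (inord j).
Proof. exact: nth_mkseq. Qed.

Lemma sum_face_coef m (i : 'I_m.+1) (s : hchain B m.+1) (f : hchain B m -> K) :
  \sum_t face_coef i s t * f t =
  \sum_k fd_mul B (s (inord i)) (s (inord i.+1)) 0 k * f [ffun j : 'I_m.+1 =>
    if j == i then k else if (j < i)%N then s (inord j) else s (inord j.+1)].
Proof.
rewrite -(sum_single_position (i := i) (P := fun t : hchain B m =>
  [forall j : 'I_m.+1, (j < i)%N ==> (t j == s (inord j))] &&
  [forall j : 'I_m.+1, (i < j)%N ==> (t j == s (inord j.+1))])).
  by apply: eq_bigr => t _; rewrite /face_coef inord_val.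
move=> t; apply/andP/forallP => [[/forallP lo /forallP hi] j|H].
  apply/implyP => ji; case: ltngtP => ji'.
  - by apply: (implyP (lo j)).
  - by apply: (implyP (hi j)).
  - by case/eqP: ji; apply: val_inj.
split; apply/forallP => j; apply/implyP => ji; have := H j.
- by rewrite ji -val_eqE neq_ltn ji.
- by rewrite -val_eqE neq_ltn ji orbT ltnNge (ltnW ji).
Qed.

Lemma sum_last_coef m (s : hchain B m.+1) (f : hchain B m -> K) :
  \sum_t last_coef s t * f t =
  \sum_k fd_mul B (s (inord m.+1)) (s (inord 0)) 0 k * f [ffun j : 'I_m.+1 =>
    if j == inord 0 then k else s (inord j)].
Proof.
rewrite -(sum_single_position (i := inord 0) (P := fun t : hchain B m =>
  [forall j : 'I_m.+1, (0 < j)%N ==> (t j == s (inord j))])) => [|t].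
  by apply: eq_bigr => t _; rewrite /last_coef.
by apply: eq_forallb => j; rewrite -[j == _]val_eqE /= inordK // lt0n.
Qed.

Lemma chain_seq_face m (i : 'I_m.+1) (s : hchain B m.+1) k :
  chain_seq [ffun j : 'I_m.+1 => if j == i then k else
    if (j < i)%N then s (inord j) else s (inord j.+1)] =
  take i (chain_seq s) ++ k :: drop i.+2 (chain_seq s).
Proof.
have zs := size_chain_seq s; have zE := nth_chain_seq s k.
move: (chain_seq s) zs zE => z zs zE; have im := ltn_ord i.
have szt : size (take i z) = i by rewrite size_takel // zs ltnW // ltnW.
apply: (@eq_from_nth _ k) => [|j].
  by rewrite size_chain_seq size_cat szt /= size_drop zs; lia.
rewrite size_chain_seq => jm; rewrite nth_chain_seq // ffunE -val_eqE /= inordK //.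
rewrite nth_cat szt; case: ltngtP => ji.
- by rewrite nth_take // zE // ltnW.
- rewrite -[in RHS](@prednK (j - i)) ?subn_gt0 //= nth_drop zE; last lia.
  by congr (s (inord _)); lia.
- by rewrite ji subnn.
Qed.

Lemma chain_seq_last m (s : hchain B m.+1) k :
  chain_seq [ffun j : 'I_m.+1 => if j == inord 0 then k else s (inord j)] =
  k :: take m (behead (chain_seq s)).
Proof.
have zs := size_chain_seq s; have zE := nth_chain_seq s k.
move: (chain_seq s) zs zE => z zs zE.
have szt : size (take m (behead z)) = m by rewrite size_takel // size_behead zs.
apply: (@eq_from_nth _ k) => [|j]; first by rewrite size_chain_seq /= szt.
rewrite size_chain_seq => jm; rewrite nth_chain_seq // ffunE -val_eqE /= !inordK //.
case: j jm => // j jm; rewrite /= nth_take // nth_behead zE //; exact: ltnW.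
Qed.

End Chains.

(** * The trace cocycle and nonzero homology classes *)

Definition trace_functional (K : fieldType) (A : fdalg K) n
    (Y : unit * 'I_(fd_dim A) -> 'M[K]_n) (u : 'M_n) m
    (t : hchain (triv_ext A) m) : K :=
  \tr (u *m wprod (triv_act Y) (chain_seq t)).

(** Degree [m.+1] means [m.+2] tensor factors, whence the sign. Expanding the product in each face
    reduces the claim to [trace_boundary]. *)
Lemma trace_cocycle (K : fieldType) (A : fdalg K) n
    (Y : unit * 'I_(fd_dim A) -> 'M[K]_n) (u : 'M_n) m :
  balanced Y -> (forall b, Y b *m u = (-1) ^+ m.+1 *: (u *m Y b)) ->
  hboundary (triv_ext A) m.+1 *m
    \col_r trace_functional Y u (enum_val r) = 0.
Proof.
move=> Ybal Yu.
apply/matrixP => r k0; rewrite !mxE; set s := enum_val r.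
pose f := @trace_functional K A n Y u m.+1.
transitivity (\sum_t (\sum_(i < m.+2) (-1) ^+ i * face_coef i s t +
    (-1) ^+ m.+2 * last_coef s t) * f t).
  rewrite [RHS](reindex (@enum_val _ (hchain (triv_ext A) m.+1))) /=.
    by apply: eq_bigr => t _; rewrite !mxE.
  exact/onW_bij/enum_val_bij.
under eq_bigr do rewrite mulrDl mulr_suml.
rewrite big_split exchange_big /=.
under eq_bigr do under eq_bigr do rewrite -mulrA.
under eq_bigr do rewrite -mulr_sumr (sum_face_coef _ s f).
under [X in _ + X]eq_bigr do rewrite -mulrA.
rewrite -mulr_sumr (sum_last_coef s f).
set z := chain_seq s; set x0 := s (inord 0).
have zE j : (j < m.+3)%N -> s (inord j) = nth x0 z j.
  by move=> jm; rewrite nth_chain_seq.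
rewrite -[RHS](trace_boundary Ybal Yu x0 (size_chain_seq s) erefl).
congr (_ + _ * _).
  apply: eq_bigr => i _; congr (_ * _).
  rewrite /trace_face -!triv_act_mul mulmx_sumr mulmx_suml mulmx_sumr raddf_sum.
  apply: eq_bigr => k _; rewrite /f /trace_functional chain_seq_face wprod_cat /=.
  rewrite (zE i (ltnW (ltn_ord i))) (zE i.+1 (ltn_ord i)).
  by rewrite -scalemxAr -scalemxAl -scalemxAr mxtraceZ !mulmxA.
rewrite -(zE m.+2) // -(zE 0%N) // -triv_act_mul mulmx_suml mulmx_sumr raddf_sum.
apply: eq_bigr => k _; rewrite /f /trace_functional chain_seq_last -cat1s.
by rewrite wprod_cat wprod1 -mxtraceZ scalemxAr scalemxAl.
Qed.

(** The tensor of dual basis vectors spelled by [w] is a cycle, as [DA] has square zero. The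
    functional kills boundaries but takes the nonzero value [\tr (u *m wprod Y w)] on it. *)
Lemma HH_nonzero_of_trace (K : fieldType) (A : fdalg K) n
    (Y : unit * 'I_(fd_dim A) -> 'M[K]_n) (u : 'M_n) w m :
  balanced Y -> size w = m.+2 ->
  (forall b, Y b *m u = (-1) ^+ m.+1 *: (u *m Y b)) ->
  \tr (u *m wprod Y w) != 0 -> HH_nonzero (triv_ext A) m.+1.
Proof.
move=> Ybal wm Yu trw.
case: w wm trw => // w0 w' wm; set w := w0 :: w' => trw.
pose t : hchain (triv_ext A) m.+1 :=
  [ffun j : 'I_m.+2 => rshift (fd_dim A) (nth w0 w j).2].
have tE : chain_seq t = [seq rshift (fd_dim A) b.2 | b <- w].
  apply: (@eq_from_nth _ (rshift _ w0.2)) => [|j].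
    by rewrite (size_chain_seq t) size_map wm.
  rewrite (size_chain_seq t) => jm.
  rewrite (nth_chain_seq t) // ffunE inordK // (nth_map w0) //.
  by rewrite wm.
apply/negP => /submxP [C cycC].
pose tr0 : 'rV[K]_(#|hchain (triv_ext A) m.+1|) := delta_mx 0 (enum_rank t).
have : (tr0 <= hcycles (triv_ext A) m.+1)%MS.
  apply/sub_kermxP; rewrite -rowE; apply/rowP => q; rewrite !mxE enum_rankK.
  have mul0 i j k : fd_mul (triv_ext A) (t i) (t j) 0 k = 0.
    rewrite !ffunE /= /triv_mul; set b := (nth _ _ i).2; set b' := (nth _ _ j).2.
    rewrite -[rshift _ b]/(unsplit (inr b)) -[rshift _ b']/(unsplit (inr b')).
    by rewrite !unsplitK mxE.
  rewrite big1 ?add0r => [|i _]; last by rewrite /face_coef mul0 !mulr0.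
  by rewrite /last_coef mul0 !mulr0.
move=> /submxP [D]; rewrite cycC => trD; case/eqP: trw.
have := congr1 (mulmx^~ (\col_r trace_functional Y u (enum_val r))) trD.
rewrite /= -!mulmxA trace_cocycle // !mulmx0 -rowE.
move=> /matrixP /(_ 0 0); rewrite !mxE enum_rankK /trace_functional tE.
suff -> : wprod (triv_act Y) [seq rshift (fd_dim A) b.2 | b <- w] = wprod Y w by [].
elim: (w) => //= -[[] b] x ->; by rewrite triv_act_rshift.
Qed.

Theorem theorem3p5 (K : closedFieldType) (A : fdalg K) :
  is_fdalg A -> selfinjective A -> HHdim_infinite (triv_ext A).
Proof.
move=> algA injA N.
have [X [Xbal Xnil]] := exists_balanced_of_selfinjective algA injA.
have [n [Y [Ybal Ynil]]] := exists_single_balanced Xbal Xnil.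
have [k [{Ybal Ynil}Y [Ybal Ynil Yirr]]] := exists_irreducible_balanced Ybal Ynil.
(* The degree is the length minus one; the bound [N.+1] makes it exceed [N], hence positive as
   [HH_nonzero_of_trace] requires. *)
have [w [u [wN Yu trw]]] := exists_signed_trace Yirr Ynil N.+1.
exists (size w).-1; split; first by lia.
case szw: (size w) wN Yu => [|[|m]] // wN Yu.
exact: (HH_nonzero_of_trace Ybal szw Yu trw).
Qed.
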